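(* Let $S$ be a set of positive diameter and of unique completion in a normed plane that is not angled, let $C$ be the completion of $S$, and let $k$ be a positive integer. Then any $k$-fold Borsuk covering $\mathcal{F}$ of $S$ can be extended to a $k$-fold Borsuk covering of $C$.
   Context: A normed plane is $\mathbb{R}^2$ equipped with a norm, with closed unit ball $\mathbf{B}$ and unit circle $\mathbb{S}=\operatorname{bd}\mathbf{B}$; diameters are taken with respect to this norm. The plane is angled if for some non-collinear points $a,b,c$ we have $[a,b]\cup[b,c]\subset\mathbb{S}$. A bounded set $C$ is complete if no set of the same diameter properly contains $C$. A bounded set $S$ is a set of unique completion if there is a unique complete set $C$ containing $S$ and having the same diameter as $S$; this $C$ is the completion of $S$. A $k$-fold Borsuk covering of a set $S$ of diameter $d>0$ is a finite (indexed) family of subsets of $S$, each of diameter strictly less than $d$, such that every point of $S$ belongs to at least $k$ members of the family. A $k$-fold Borsuk covering $\{Q_1,\dots,Q_m\}$ of $S$ can be extended to a $k$-fold Borsuk covering of a set $C\supseteq S$ of the same diameter if there is a $k$-fold Borsuk covering $\{Q_1',\dots,Q_m'\}$ of $C$ with $Q_i\subseteq Q_i'$ for every $i$. *)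

(* Defs.v *)
From mathcomp Require Import all_boot all_order all_algebra.
From mathcomp Require Import all_classical all_reals all_analysis.
Set Implicit Arguments.
Unset Strict Implicit.
Unset Printing Implicit Defensive.
Import Order.TTheory GRing.Theory Num.Theory.
Import numFieldNormedType.Exports.
#[global] Open Scope classical_set_scope.
#[global] Open Scope ring_scope.

(* The norm of the normed plane is an explicit function N; it is unrelated to
   the library norm `|x| on 'rV[R]_2, of which only the (usual Euclidean)
   topology is used below. *)
Record is_norm (R : realType) (N : 'rV[R]_2 -> R) : Prop := IsNorm {
  norm_ge0 : forall x, 0 <= N x;
  norm_definite : forall x, N x = 0 -> x = 0;
  norm_homogeneous : forall (t : R) x, N (t *: x) = `|t| * N x;
  norm_triangle : forall x y, N (x + y) <= N x + N y }.

Definition unit_ball (R : realType) (N : 'rV[R]_2 -> R) : set 'rV[R]_2 :=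
  [set x | N x <= 1].

Definition unit_circle (R : realType) (N : 'rV[R]_2 -> R) : set 'rV[R]_2 :=
  closure (unit_ball N) `\` interior (unit_ball N).

Definition segment (R : realType) (a b : 'rV[R]_2) : set 'rV[R]_2 :=
  [set (1 - t) *: a + t *: b | t in `[0, 1]].

Definition collinear (R : realType) (a b c : 'rV[R]_2) : Prop :=
  exists p v : 'rV[R]_2,
    [set a; b; c] `<=` [set p + t *: v | t in [set: R]].

Definition angled (R : realType) (N : 'rV[R]_2 -> R) : Prop :=
  exists a b c : 'rV[R]_2,
    ~ collinear a b c /\ segment a b `|` segment b c `<=` unit_circle N.

Definition norm_bounded (R : realType) (N : 'rV[R]_2 -> R)
    (A : set 'rV[R]_2) : Prop :=
  exists M : R, forall x, A x -> N x <= M.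

(* Extended-real valued: +oo exactly on the unbounded sets, and -oo (rather
   than 0) on the empty set, so in both conventions the empty set has diameter
   less than any d > 0. *)
Definition diam (R : realType) (N : 'rV[R]_2 -> R)
    (A : set 'rV[R]_2) : \bar R :=
  ereal_sup [set (N (x - y))%:E | x in A & y in A].

Definition complete_set (R : realType) (N : 'rV[R]_2 -> R)
    (C : set 'rV[R]_2) : Prop :=
  norm_bounded N C /\ ~ exists D, C `<` D /\ diam N D = diam N C.

Definition is_completion (R : realType) (N : 'rV[R]_2 -> R)
    (S C : set 'rV[R]_2) : Prop :=
  [/\ complete_set N C, S `<=` C & diam N C = diam N S].

Definition unique_completion (R : realType) (N : 'rV[R]_2 -> R)
    (S : set 'rV[R]_2) : Prop :=
  norm_bounded N S /\ exists! C, is_completion N S C.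

(* The last clause counts indices, so that repeated members of the family
   count with multiplicity. *)
Definition borsuk_covering (R : realType) (N : 'rV[R]_2 -> R) (k : nat)
    (S : set 'rV[R]_2) (m : nat) (Q : 'I_m -> set 'rV[R]_2) : Prop :=
  [/\ forall i, Q i `<=` S,
      forall i, (diam N (Q i) < diam N S)%E &
      forall x, S x -> (k <= #|[pred i | x \in Q i]|)%N].

(* Main.v *)
Require Import Defs.
From mathcomp Require Import all_boot all_order all_algebra.
From mathcomp Require Import all_classical all_reals all_analysis.
From mathcomp Require Import ring lra.

(** Let d be the diameter of S. Uniqueness of the completion means that C is
    the intersection of the balls of radius d centered at the points of S, so
    every point at distance at least d from some point of C is at distance at
    least d from some point of the closure of S.

    For p in C let op(p) be the set of points of C at distance d from p. The
    key fact is that op(p) is contained in op(q) for some q in the closure of S.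
    If p is not in the closure of S and x, y are in op(p), then each point z at
    distance d from p in the cone spanned by x and y at p has an opposite s <> p
    in the closure of S; comparing sides and diagonals of quadrilaterals shows
    that the sphere about p contains [x, z] or [z, y]. By continuity some z is
    of both kinds, and since the plane is not angled, [x, y] itself lies in this
    sphere. So op(p) lies on a line, and an opposite q of the midpoint of a
    longest segment with endpoints in op(p) does the job: the distance to q is
    convex, at most d, and equal to d at the midpoint.

    Hence every point of C has, for at least k indices i, all its distances to
    Q_i less than d, uniformly so by compactness. One can therefore add to Q_i
    all such points lying in one fixed small ball without creating pairs at
    distance d. The enlarged covering is again of the same form, and finitely
    many small balls cover C. *)

Set Implicit Arguments.
Unset Strict Implicit.
Unset Printing Implicit Defensive.
Import Order.TTheory GRing.Theory Num.Theory.
Import numFieldNormedType.Exports.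
Local Open Scope classical_set_scope.
Local Open Scope ring_scope.

(** * Triangle inequalities and quadrilaterals in a normed plane *)

Section NormedPlane.
Variables (R : realType) (N : 'rV[R]_2 -> R) (hN : is_norm N).
Implicit Types (x y z s p : 'rV[R]_2) (a b c d : R).

Let N_ge0 x : 0 <= N x. Proof. exact: norm_ge0. Qed.

Lemma norm0 : N 0 = 0.
Proof. by rewrite -(scale0r 0) norm_homogeneous // normr0 mul0r. Qed.

Lemma normZ_ge0 a x : 0 <= a -> N (a *: x) = a * N x.
Proof. by move=> a0; rewrite norm_homogeneous // ger0_norm. Qed.

Lemma normN x : N (- x) = N x.
Proof. by rewrite -scaleN1r norm_homogeneous // normrN1 mul1r. Qed.

Lemma normDxx x : N (x + x) = 2 * N x.
Proof. by rewrite -[x + x]mulr2n -scaler_nat normZ_ge0. Qed.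

Lemma norm_distC x y : N (x - y) = N (y - x).
Proof. by rewrite -normN opprB. Qed.

Lemma norm_dist_triangle z x y : N (x - y) <= N (x - z) + N (z - y).
Proof. by rewrite -[x - y](subrKA z); exact: norm_triangle. Qed.

(** A division-free triangle inequality: vector identities can be left to [ring] and the resulting
    bounds to [lra] or [nra]. *)
Lemma norm_le_comb a b c x y z : 0 <= a -> 0 <= b -> 0 <= c ->
  c *: z = a *: x + b *: y -> c * N z <= a * N x + b * N y.
Proof.
by move=> a0 b0 c0 e; rewrite -!normZ_ge0// e; exact: norm_triangle.
Qed.

(* Either [s] lies in the cone opposite to that of [x] and [y], which forces
   [s = 0], or the segment from [s] to one of [x], [y] crosses [[0, z]]; there
   the diagonals of a quadrilateral have length at most [d] and two opposite
   sides have length at least [d], so that all triangle inequalities used are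
   equalities. *)
Lemma flat_of_opposite x y z s (l m al be d : R) : 0 < d ->
  N x = d -> N y = d -> N z = d -> N (x - y) <= d ->
  0 <= l -> 0 <= m -> z = l *: x + m *: y ->
  s = al *: x + be *: y -> s != 0 ->
  N s <= d -> N (s - x) <= d -> N (s - y) <= d -> d <= N (z - s) ->
  2 * d <= N (z + x) \/ 2 * d <= N (z + y).
Proof.
move=> d0.
have notnpos u v t (a b : R) : N u = d -> N (u - v) <= d -> N (t - u) <= d ->
    a <= 0 -> b <= 0 -> t = a *: u + b *: v -> 0 <= a.
  move=> Nu Nuv Ntu a0 b0 et.
  have := @norm_le_comb 1 (- b) (1 - a - b) (u - t) (u - v) u ler01.
  rewrite norm_distC in Ntu; rewrite Nu oppr_ge0 => /(_ b0) H.
  have {H} : (1 - a - b) * d <= 1 * N (u - t) + - b * N (u - v).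
    by apply: H; [lra | rewrite et; apply/rowP => i; rewrite !mxE; ring].
  by nra.
have main u v t (l' m' a b : R) : N u = d -> N v = d -> N z = d ->
    N (u - v) <= d -> 0 <= l' -> 0 <= m' -> z = l' *: u + m' *: v ->
    t = a *: u + b *: v -> t != 0 -> N t <= d -> N (t - u) <= d ->
    N (t - v) <= d -> d <= N (z - t) -> 0 <= a * m' - l' * b ->
    2 * d <= N (z + v).
  move=> Nu Nv Nz Nuv l0 m0 ez et t0 Nt Ntu Ntv Nzt.
  set D := (X in 0 <= X) => D0.
  have [l'0|lp] := eqVneq l' 0.
    move: Nz; rewrite ez l'0 scale0r add0r normZ_ge0// Nv => m1.
    have -> : m' = 1 by apply: (mulIf (lt0r_neq0 d0)); rewrite mul1r.
    by rewrite scale1r normDxx Nv.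
  have {}l0 : 0 < l' by rewrite lt_neqAle eq_sym lp.
  have key : a *: z = l' *: t + D *: v.
    by rewrite ez et /D; apply/rowP => i; rewrite !mxE; ring.
  have [a0|a0] := leP a 0.
    have b0 : b <= 0 by rewrite /D in D0; nra.
    have a0' := notnpos _ _ _ _ _ Nu Nuv Ntu a0 b0 et.
    have b0' : 0 <= b.
      apply: (notnpos v u t b a) => //; first by rewrite norm_distC.
      by rewrite addrC.
    by move: t0; rewrite et (le_anti (introT andP (conj a0 a0')))
      (le_anti (introT andP (conj b0 b0'))) !scale0r addr0 eqxx.
  (* Divided by [l' + D], [key] locates the point where the segment from [t] to [v] crosses the one
     from [0] to [z]. The triangles it forms with the opposite sides [[0, v]] and [[t, z]] give
     [D <= a] and [a <= D]. *)
  have aD : a <= l' + D.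
    by have := norm_le_comb (ltW l0) D0 (ltW a0) key; nra.
  rewrite norm_distC in Ntv.
  have Da : D <= a.
    have := @norm_le_comb a l' (D + l') z (v - t) v (ltW a0) (ltW l0).
    rewrite Nv Nz => H.
    have {H} : (D + l') * d <= a * d + l' * N (v - t).
      apply: H; first by lra.
      by rewrite key scalerBr scalerDl; apply/rowP => i; rewrite !mxE; ring.
    by nra.
  have {}aD : a = D.
    apply/eqP; rewrite eq_le Da andbT.
    have := @norm_le_comb (D + l' - a) D (D + l') z (v - t) (z - t).
    rewrite Nz => H.
    have {H} : (D + l') * N (z - t) <= (D + l' - a) * d + D * N (v - t).
      apply: H; [lra | lra | lra |].
      apply/rowP => i; move/rowP: key => /(_ i); rewrite !mxE => k.
      apply/eqP; rewrite -subr_eq0; apply/eqP.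
      by transitivity (a * z ord0 i - (l' * t ord0 i + D * v ord0 i));
        [ring | rewrite k; ring].
    by nra.
  have : (2 * a + l') * N v <= a * N (z + v) + l' * N (v - t).
    apply: norm_le_comb; [lra | lra | lra |].
    apply/rowP => i; move/rowP: key => /(_ i); rewrite !mxE -aD => k.
    have -> : a * (z ord0 i + v ord0 i) + l' * (v ord0 i - t ord0 i) =
      a * z ord0 i + a * v ord0 i + l' * (v ord0 i - t ord0 i) by ring.
    by rewrite k; ring.
  by rewrite Nv; nra.
move=> Nx Ny Nz Nxy l0 m0 ez es s0 Ns Nsx Nsy Nzs.
(* This is the coefficient of [v] in [key]; exchanging [x] and [y] changes its sign. *)
have [D0|D0] := leP 0 (al * m - l * be).
  by right; apply: (main x y s l m al be).
left; apply: (main y x s m l be al) => //.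
- by rewrite norm_distC.
- by rewrite addrC.
- by rewrite addrC.
- by lra.
Qed.

End NormedPlane.

(** * Continuity and compactness for [N]; flat segments on spheres *)

Section NormTopology.
Variables (R : realType) (N : 'rV[R]_2 -> R) (hN : is_norm N).
Implicit Types (x y z s p : 'rV[R]_2) (a b c d : R).
Let N_ge0 x : 0 <= N x. Proof. exact: norm_ge0. Qed.

Lemma coord_le_mx_norm x j : `|x ord0 j| <= `|x|.
Proof.
by rewrite [leRHS]/Num.norm /= mx_normrE; apply/bigmax_geP; right => /=;
  exists (ord0, j).
Qed.

Lemma norm_le_mx_norm : exists2 K, 0 < K & forall x, N x <= K * `|x|.
Proof.
exists (\sum_j N (delta_mx ord0 j) + 1) => [|x].
  by rewrite ltr_wpDl// sumr_ge0.
rewrite {1}[x]row_sum_delta mulrDl mul1r ler_wpDr//.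
have le_sum (I : Type) (r : seq I) (F : I -> 'rV[R]_2) :
    N (\sum_(i <- r) F i) <= \sum_(i <- r) N (F i).
  elim: r => [|i r IH]; first by rewrite !big_nil norm0.
  by rewrite !big_cons (le_trans (norm_triangle hN _ _))// lerD2l.
apply: le_trans (le_sum _ _ _) _.
rewrite mulr_suml; apply: ler_sum => j _.
by rewrite norm_homogeneous// mulrC ler_wpM2l// coord_le_mx_norm.
Qed.

Lemma plane_norm_continuous : continuous N.
Proof.
have [K K0 NK] := norm_le_mx_norm.
move=> x; apply/(@cvgrPdist_le _ _ _ (nbhs x) (nbhs_filter x)) => e e0.
have /cvgrPdist_le : id @ x --> x by exact: cvg_id.
move=> /(_ (e / K) (divr_gt0 e0 K0)); apply: filterS => y xy.
have {xy} : N (x - y) <= e by rewrite (le_trans (NK _))// mulrC -ler_pdivlMr.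
have := norm_triangle hN (x - y) y; rewrite subrK.
have := norm_triangle hN (y - x) x; rewrite subrK norm_distC// => H1 H2 H3.
by rewrite ler_norml; apply/andP; split; lra.
Qed.

Lemma continuous_dist p : continuous (fun x => N (x - p)).
Proof.
have sub_cont (V : normedModType R) (q : V) : continuous (fun v : V => v - q).
  by move=> v; apply: cvgB; [exact: cvg_id|exact: cvg_cst].
by move=> x; exact: (continuous_comp (@sub_cont _ p x) (@plane_norm_continuous _)).
Qed.

Lemma closed_norm_ball p c : closed [set x | N (x - p) <= c].
Proof.
apply: (@closed_comp _ _ (fun x => N (x - p)) [set t | t <= c]).
  by move=> x _; exact: continuous_dist.
exact: closed_le.
Qed.

(** [N] attains a positive minimum on the compact unit sphere of the library norm; its inverse is
    the constant. *)
Lemma mx_norm_le_norm : exists c, forall x, `|x| <= c * N x.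
Proof.
pose A : set 'rV[R]_2 := [set x | `|x| = 1].
have nA x : x != 0 -> A (`|x|^-1 *: x).
  by move=> x0; rewrite /A /= normrZ normfV normr_id mulVf// normr_eq0.
have [x0|/set0P[u Au]] := eqVneq A set0.
  exists 0 => x; rewrite mul0r; have [->|/nA] := eqVneq x 0.
    by rewrite normr0.
  by rewrite x0.
have cA : compact A.
  apply: bounded_closed_compact.
    by exists 1; split => // M M1 x /= ->; exact: ltW.
  apply: (@closed_comp _ _ (fun x : 'rV[R]_2 => `|x|) [set 1]).
    by move=> x _; exact: norm_continuous.
  exact: closed_eq.
have [|v] := compact_EVT_min (ex_intro _ u Au) cA (f := N).
  by apply: continuous_subspaceT; exact: plane_norm_continuous.
rewrite inE => Av minv.
have Nv : 0 < N v.
  rewrite lt_neqAle N_ge0 andbT eq_sym; apply/eqP => /(norm_definite hN) v0.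
  by move: Av; rewrite v0 /A /= normr0 => /eqP; rewrite eq_sym oner_eq0.
exists (N v)^-1 => x; have [->|x0] := eqVneq x 0.
  by rewrite normr0 mulr_ge0// invr_ge0.
have := minv _ (mem_set (nA _ x0)).
rewrite normZ_ge0// ?invr_ge0//.
have nx : 0 < `|x| by rewrite normr_gt0.
by rewrite !ler_pdivlMl// mulrC.
Qed.

Lemma norm_bounded_closed_compact (A : set 'rV[R]_2) :
  norm_bounded N A -> closed A -> compact A.
Proof.
move=> [M NM] cA; apply: bounded_closed_compact => //.
have [c cN] := mx_norm_le_norm.
exists (`|c| * M); split; first exact: num_real.
move=> e /ltW Me x Ax; apply: le_trans Me; apply: le_trans (cN x) _.
apply: (@le_trans _ _ (`|c| * N x)); first by rewrite ler_wpM2r// ler_norm.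
by rewrite ler_wpM2l// NM.
Qed.

(** The points [t *: x] with [t] slightly above [1] leave the ball, so [x] is not interior. *)
Lemma norm1_unit_circle x : N x = 1 -> unit_circle N x.
Proof.
move=> Nx; split; first by apply: subset_closure; rewrite /unit_ball /= Nx.
rewrite /interior /= => xB.
have : \forall t \near (1 : R), unit_ball N (t *: x).
  have : (fun t : R => t *: x) @ (1 : R) --> (1 : R) *: x.
    by apply: cvgZr_tmp; exact: cvg_id.
  by rewrite scale1r; apply.
case/nbhs_ballP => e /= e0 /(_ (1 + e / 2)) B.
have {B} : unit_ball N ((1 + e / 2) *: x).
  apply: B; rewrite /ball /= opprD addNKr normrN ger0_norm ?divr_ge0 ?ltW//.
  by lra.
by rewrite /unit_ball /= normZ_ge0// ?Nx; lra.
Qed.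

(** The midpoint of [x] and [y] has norm at least [1] and lies between [z] and one of the endpoints,
    so convexity excludes [N z < 1]. *)
Lemma flat_segment x y (t : R) : N x = 1 -> N y = 1 -> 2 <= N (x + y) ->
  0 <= t <= 1 -> N ((1 - t) *: x + t *: y) = 1.
Proof.
move=> Nx Ny Nxy /andP[t0 t1]; set z := (X in N X).
have le1 : N z <= 1.
  have := @norm_le_comb _ _ hN (1 - t) t 1 x y z.
  by rewrite Nx Ny scale1r => /(_ _ t0 ler01 erefl); lra.
apply/eqP; rewrite eq_le le1 /=.
have [tl|tl] := leP t (1 / 2).
  have := @norm_le_comb _ _ hN 1 (1 - 2 * t) (1 - t) z y (x + y).
  rewrite Ny => H; have {H} : (1 - t) * N (x + y) <= 1 * N z + (1 - 2 * t) * 1.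
    apply: H; [lra | lra | lra |].
    by apply/rowP => i; rewrite !mxE; ring.
  by nra.
have := @norm_le_comb _ _ hN 1 (2 * t - 1) t z x (x + y).
rewrite Nx => H; have {H} : t * N (x + y) <= 1 * N z + (2 * t - 1) * 1.
  apply: H; [lra | lra | lra |].
  by apply/rowP => i; rewrite !mxE; ring.
by nra.
Qed.

(** Carried to the unit circle, the two flat segments share the endpoint [h y]; without collinearity
    they would form an angle. *)
Lemma flat_collinear d p x y w : ~ angled N -> 0 < d ->
  N (x - p) = d -> N (y - p) = d -> N (w - p) = d ->
  2 * d <= N ((x - p) + (y - p)) -> 2 * d <= N ((y - p) + (w - p)) ->
  collinear x y w.
Proof.
move=> nang d0 Nx Ny Nw Nxy Nyw.
pose h u := d^-1 *: (u - p).
have hK u : u = p + d *: h u.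
  by rewrite /h scalerA divff ?lt0r_neq0// scale1r addrC subrK.
have Nh u : N (u - p) = d -> N (h u) = 1.
  by move=> e; rewrite normZ_ge0// ?invr_ge0 ?(ltW d0)// e mulVf// lt0r_neq0.
have Nhh u v : 2 * d <= N ((u - p) + (v - p)) -> 2 <= N (h u + h v).
  move=> e; rewrite -scalerDr normZ_ge0// ?invr_ge0 ?(ltW d0)//.
  by rewrite ler_pdivlMl// mulrC.
have : collinear (h x) (h y) (h w).
  apply: contrapT => ncol; apply: nang; exists (h x), (h y), (h w).
  split => // _ [] [t /itvP tP <-]; apply: norm1_unit_circle;
    by apply: flat_segment; rewrite ?tP//; auto.
move=> [q [v sub]]; exists (p + d *: q), (d *: v) => u uP.
have /sub : [set h x; h y; h w] (h u).
  by case: uP => [[->|->]|->]; [left;left|left;right|right].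
case=> t _ e; exists t => //.
by rewrite [RHS](hK u) -e scalerDr !scalerA -addrA [d * t]mulrC.
Qed.

Definition det2 x y : R :=
  x ord0 ord0 * y ord0 ord_max - x ord0 ord_max * y ord0 ord0.

(** Dependent vectors of equal norm [d] are equal or opposite, and opposite ones are at distance
    [2 * d]. *)
Lemma norm_eq_det2_neq0 d x y : 0 < d -> N x = d -> N y = d -> N (x - y) <= d ->
  x != y -> det2 x y != 0.
Proof.
move=> d0 Nx Ny Nxy xy; apply/eqP; rewrite /det2 => det0.
have ord2 (i : 'I_2) : i = ord0 \/ i = ord_max.
  by case: i => -[|[|//]] ?; [left|right]; exact: val_inj.
have par i : y ord0 i *: x = x ord0 i *: y.
  apply/rowP => j; rewrite !mxE; apply/eqP; rewrite -subr_eq0; apply/eqP.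
  case: (ord2 i) => ->; case: (ord2 j) => ->; first by ring.
  - by rewrite -[RHS]oppr0 -[in RHS]det0; ring.
  - by rewrite -[RHS]det0; ring.
  - by ring.
have nr i : `|y ord0 i| = `|x ord0 i|.
  have /(congr1 N) := par i; rewrite !norm_homogeneous// Nx Ny.
  exact/mulIf/lt0r_neq0.
have [i xi] : exists i, x ord0 i != 0.
  apply: contrapT => n; move: d0; rewrite -Nx; suff -> : x = 0.
    by rewrite norm0// ltxx.
  apply/rowP => i; rewrite mxE; apply/eqP; apply: contrapT => ni.
  by apply: n; exists i; exact/negP.
have /eqP := nr i; rewrite eqr_norm2 => /orP[] /eqP e.
  have := par i; rewrite e => /(scalerI xi) exy.
  by rewrite exy eqxx in xy.
have := par i; rewrite e scaleNr -scalerN => /(scalerI xi) exy.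
by move: Nxy; rewrite -exy opprK normDxx// Nx; lra.
Qed.

End NormTopology.

(** * Opposite points in a set cut out by balls *)

Section SphericalHull.
Variables (R : realType) (N : 'rV[R]_2 -> R) (hN : is_norm N).
Implicit Types (x y z s p : 'rV[R]_2) (a b c d : R).
Let N_ge0 x : 0 <= N x. Proof. exact: norm_ge0. Qed.

Lemma cramer2 x y s : det2 x y != 0 ->
  s = (det2 s y / det2 x y) *: x + (det2 x s / det2 x y) *: y.
Proof.
move=> D0; apply/rowP => i; rewrite !mxE /det2.
have D0' : x ord0 ord0 * y ord0 ord_max - x ord0 ord_max * y ord0 ord0 != 0.
  by [].
have [->|->] : i = ord0 \/ i = ord_max.
  by case: i => -[|[|//]] ?; [left|right]; exact: val_inj.
- by field.
- by field.
Qed.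

Lemma collinear_comb_coef x y (l m : R) : det2 x y != 0 ->
  collinear x (l *: x + m *: y) y -> l + m = 1.
Proof.
move=> D0 [q [v sub]].
have [t1 _ e1] : [set q + t *: v | t in [set: R]] x by apply: sub; left; left.
have [t2 _ e2] : [set q + t *: v | t in [set: R]] (l *: x + m *: y).
  by apply: sub; left; right.
have [t3 _ e3] : [set q + t *: v | t in [set: R]] y by apply: sub; right.
have E : (l + m - 1) * det2 x y =
    det2 (l *: x + m *: y - x) (y - x).
  by rewrite /det2 !mxE; ring.
have : (l + m - 1) * det2 x y = 0.
  by rewrite E -e2 -e1 -e3 /det2 !mxE; ring.
by move/eqP; rewrite mulf_eq0 (negbTE D0) orbF subr_eq0 => /eqP.
Qed.

(** For [t < 1], the vector in the last hypothesis is [(1 - t) *: (x + y) + (2 * t) *: y], whose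
    second term contributes at most [2 * t * d]. *)
Lemma flat_mid d x y (t : R) : N x = d -> N y = d ->
  N ((1 - t) *: x + t *: y) = d -> 0 <= t <= 1 ->
  2 * d <= N ((1 - t) *: x + t *: y + x) ->
  2 * d <= N ((1 - t) *: x + t *: y + y) -> 2 * d <= N (x + y).
Proof.
move=> Nx Ny Nz /andP[t0 t1] zx zy.
have d0 : 0 <= d by rewrite -Nx.
have [t1'|t1'] := eqVneq t 1.
  by move: zx; rewrite t1' subrr scale0r add0r scale1r addrC.
have {}t1 : t < 1 by rewrite lt_neqAle t1' t1.
have := @norm_le_comb _ _ hN (1 - t) (2 * t) 1 (x + y) y
  ((1 - t) *: x + t *: y + y).
rewrite Ny => H.
have {H} : 1 * N ((1 - t) *: x + t *: y + y) <=
    (1 - t) * N (x + y) + 2 * t * d.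
  by apply: H; [lra | lra | lra |]; apply/rowP => i; rewrite !mxE; ring.
by nra.
Qed.

(** In the application [T] is the closure of [S], possibly enlarged within [C]. *)
Variables (T C : set 'rV[R]_2) (d : R).
Hypotheses (d_gt0 : 0 < d) (T_compact : compact T) (T0 : T !=set0)
  (TC : T `<=` C) (C_diam : forall x y, C x -> C y -> N (x - y) <= d)
  (T_hull : forall z, (forall s, T s -> N (z - s) <= d) -> C z).

(** If all of [T] were closer than [d] to [z], then [z] pushed slightly away from [p] would still be
    in [C], at distance more than [d] from [p]. *)
Lemma opposite_point p z : C p -> d <= N (z - p) ->
  exists2 s, T s & d <= N (z - s).
Proof.
move=> Cp zp.
have [|s] := compact_EVT_max T0 T_compact (f := fun s => N (s - z)).
  by apply: continuous_subspaceT; exact: continuous_dist.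
rewrite inE => Ts maxs; exists s => //.
rewrite leNgt; apply/negP => sz.
have zp0 : 0 < N (z - p) by apply: lt_le_trans zp.
(* The displacement [e *: (z - p)] uses up exactly the slack [d - N (z - s)]. *)
pose e := (d - N (z - s)) / N (z - p).
have e0 : 0 < e by rewrite divr_gt0// subr_gt0.
suff /C_diam/(_ Cp) : C (z + e *: (z - p)).
  rewrite (_ : _ - p = (1 + e) *: (z - p)); last first.
    by rewrite scalerDl scale1r addrAC.
  by rewrite normZ_ge0//; [nra | lra].
apply: T_hull => t /mem_set/maxs.
rewrite [N (t - z)]norm_distC// [N (s - z)]norm_distC// => ts.
rewrite addrAC; apply: le_trans (norm_triangle hN _ _) _.
by rewrite normZ_ge0 ?(ltW e0)// /e divfK ?gt_eqF//; lra.
Qed.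

(** The conclusion puts the midpoint of [x] and [y] at distance at least [d] from [p], which by
    convexity means that the sphere about [p] contains the whole segment. *)
Lemma opposite_flat p x y : ~ angled N -> C p -> ~ T p -> C x -> C y ->
  N (x - p) = d -> N (y - p) = d -> 2 * d <= N ((x - p) + (y - p)).
Proof.
move=> nang Cp Tp Cx Cy Nx Ny.
set u := x - p; set v := y - p.
have uv : u - v = x - y by rewrite /u /v opprB addrA subrK.
have Nuv : N (u - v) <= d by rewrite uv; exact: C_diam.
have [e|ne] := eqVneq u v; first by rewrite -e normDxx// Nx.
have D0 : det2 u v != 0 by apply: (norm_eq_det2_neq0 hN d_gt0).
pose z0 (t : R) := (1 - t) *: u + t *: v.
(* At a zero of [f], flatness towards [u] and flatness towards [v] are equivalent, by [flat_z]
   below. *)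
pose f t := N (z0 t + v) - N (z0 t + u).
have cz0 : continuous z0.
  have cgen (V : normedModType R) (a b : V) :
      continuous (fun t : R => (1 - t) *: a + t *: b).
    move=> t; apply: cvgD; apply: cvgZr_tmp; last exact: cvg_id.
    by apply: cvgB; [exact: cvg_cst | exact: cvg_id].
  exact: cgen.
have cNz w : continuous (fun t => N (z0 t + w)).
  move=> t; rewrite -[w]opprK.
  exact: (continuous_comp (@cz0 t) (@continuous_dist _ _ hN (- w) _)).
have cf : continuous f by move=> t; apply: cvgB; exact: cNz.
have f0 : f 0 <= 0.
  rewrite /f /z0 subr0 scale1r scale0r addr0 normDxx// subr_le0.
  by rewrite (le_trans (norm_triangle hN _ _))// Nx Ny mulr_natl mulr2n.
have f1 : 0 <= f 1.
  rewrite /f /z0 subrr scale0r add0r scale1r normDxx// subr_ge0.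
  by rewrite (le_trans (norm_triangle hN _ _))// Nx Ny mulr_natl mulr2n.
have [||t] := @IVT R f 0 1 0 ler01.
- exact: continuous_subspaceT.
- by rewrite ge_min f0 le_max f1 orbT.
rewrite in_itv /= => t01 ft.
have /andP[t0 t1] := t01.
have Nz_le : N (z0 t) <= d.
  have := @norm_le_comb _ _ hN (1 - t) t 1 u v (z0 t).
  by rewrite Nx Ny scale1r => /(_ _ t0 ler01 erefl); lra.
(* Adding [H1] and [H2] gives [2 * d <= 2 * N (z0 t) + d]. *)
have Nz_gt0 : 0 < N (z0 t).
  have H1 : N u <= N (z0 t) + t * N (u - v).
    rewrite -(normZ_ge0 hN _ t0); apply: le_trans (norm_triangle hN _ _).
    rewrite (_ : z0 t + _ = u) //.
    by rewrite /z0; apply/rowP => i; rewrite !mxE; ring.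
  have H2 : N v <= N (z0 t) + (1 - t) * N (v - u).
    have t1' : 0 <= 1 - t by lra.
    rewrite -(normZ_ge0 hN _ t1'); apply: le_trans (norm_triangle hN _ _).
    rewrite (_ : z0 t + _ = v) //.
    by rewrite /z0; apply/rowP => i; rewrite !mxE; ring.
  move: H1 H2; rewrite Nx Ny [N (v - u)]norm_distC// => H1 H2.
  have := ler_wpM2l t0 Nuv.
  have : (1 - t) * N (u - v) <= (1 - t) * d by rewrite ler_wpM2l// subr_ge0.
  move: H1 H2 d_gt0; rewrite !mulrBl !mul1r.
  by move: (N _) (N _) (t * _) (t * _) => M w tM td; lra.
pose r := d / N (z0 t).
have r1 : 1 <= r by rewrite /r ler_pdivlMr// mul1r.
have r0 : 0 <= r by lra.
have rNz : r * N (z0 t) = d by rewrite /r divfK// gt_eqF.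
pose z := r *: z0 t.
have Nz : N z = d by rewrite normZ_ge0.
(* Both sides are the equality case of the triangle inequality, which is unaffected by rescaling
   [z0 t] to [z]. *)
have flat_z w : N w = d -> (2 * d <= N (z + w)) <-> (N (z0 t) + d <= N (z0 t + w)).
  move=> Nw; split => H.
    have := @norm_le_comb _ _ hN 1 (r - 1) 1 (z0 t + w) (z0 t) (z + w) ler01.
    have -> : 1 *: (z + w) = 1 *: (z0 t + w) + (r - 1) *: z0 t.
      by rewrite /z; apply/rowP => i; rewrite !mxE; ring.
    by move=> /(_ _ ler01 erefl); lra.
  have := @norm_le_comb _ _ hN 1 (r - 1) r (z + w) w (z0 t + w) ler01.
  have -> : r *: (z0 t + w) = 1 *: (z + w) + (r - 1) *: w.
    by rewrite /z; apply/rowP => i; rewrite !mxE; ring.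
  by rewrite Nw => /(_ _ r0 erefl); nra.
have [s Ts zs] : exists2 s, T s & d <= N (z + p - s).
  by apply: (@opposite_point p) => //; rewrite addrK Nz.
have Cs := TC Ts.
have flat : 2 * d <= N (z + u) \/ 2 * d <= N (z + v).
  apply: (@flat_of_opposite _ _ hN u v z (s - p) (r * (1 - t)) (r * t) _ _
    d d_gt0 Nx Ny Nz Nuv _ _ _ (cramer2 (s - p) D0)).
  - by rewrite mulr_ge0//; lra.
  - by rewrite mulr_ge0.
  - by rewrite /z /z0 scalerDr !scalerA.
  - by rewrite subr_eq0; apply: contra_not_neq Tp => <-.
  - exact: C_diam.
  - by rewrite /u opprB addrA subrK; exact: C_diam.
  - by rewrite /v opprB addrA subrK; exact: C_diam.
  - by rewrite opprB addrA.
have [{flat}zu zv] : 2 * d <= N (z + u) /\ 2 * d <= N (z + v).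
  have e : N (z0 t + v) = N (z0 t + u) by apply/eqP; rewrite -subr_eq0 -/(f t) ft.
  by case: flat => H; split => //; apply/flat_z => //; move/flat_z: H;
    rewrite ?Nx ?Ny e; apply.
(* Two flat segments meet at [z], so [z] is on the line through [u] and [v]; this forces [r = 1],
   that is, [z = z0 t]. *)
have : collinear u z v.
  apply: (@flat_collinear _ _ hN d 0) => //; rewrite ?subr0//.
  by rewrite addrC.
rewrite /z /z0 scalerDr !scalerA => /(collinear_comb_coef D0).
rewrite -mulrDr subrK mulr1 => r1'.
move: Nz zu zv; rewrite /z r1' scale1r => Nz zu zv.
exact: (flat_mid (t := t)).
Qed.

Lemma opposite_dominated p : ~ angled N -> C p -> closed C ->
  exists2 q, T q & forall x, C x -> d <= N (x - p) -> d <= N (x - q).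
Proof.
move=> nang Cp Ccl.
have [Tp|Tp] := pselect (T p); first by exists p.
pose P := C `&` [set x | d <= N (x - p)].
have [P0|/set0P P0] := eqVneq P set0.
  case: T0 => q Tq; exists q => // x Cx xp.
  by suff : P x by rewrite P0.
have Pp x : P x -> N (x - p) = d.
  by move=> [Cx xp]; apply/eqP; rewrite eq_le xp C_diam.
have cP : compact P.
  apply: (norm_bounded_closed_compact hN).
    exists (d + N p) => x /Pp xp.
    by have := norm_triangle hN (x - p) p; rewrite subrK xp.
  apply: closedI => //.
  apply: (@closed_comp _ _ (fun x => N (x - p)) [set y | d <= y]).
    by move=> x _; exact: continuous_dist.
  exact: closed_ge.
have [xy] : exists2 xy, xy \in P `*` P &
    forall uv, uv \in P `*` P -> N (uv.1 - uv.2) <= N (xy.1 - xy.2).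
  apply: (@compact_EVT_max ('rV[R]_2 * 'rV[R]_2)%type R
    (fun uv => N (uv.1 - uv.2)) (P `*` P)).
  - by case: P0 => o Po; exists (o, o).
  - exact: compact_setX.
  - apply: continuous_subspaceT.
    have cgen (V : normedModType R) :
        continuous (fun uv : V * V => uv.1 - uv.2).
      by move=> uv; apply: cvgB; [exact: cvg_fst | exact: cvg_snd].
    move=> uv; apply: (continuous_comp (@cgen _ uv)).
    exact: plane_norm_continuous.
case: xy => x y; rewrite inE => -[/= Px Py] maxxy.
have flatxy := opposite_flat nang Cp Tp.
pose m := 2^-1 *: (x + y).
have dm : d <= N (m - p).
  have -> : m - p = 2^-1 *: ((x - p) + (y - p)).
    by rewrite /m; apply/rowP => i; rewrite !mxE; field.
  rewrite normZ_ge0// ler_pdivlMl//.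
  by apply: flatxy => //; [exact: Px.1|exact: Py.1|exact: Pp|exact: Pp].
have [s Ts ms] := opposite_point Cp dm.
exists s => // w Cw wp.
have Pw : P w by [].
have Cs := TC Ts.
have [q [v sub]] : collinear x y w.
  by apply: (@flat_collinear _ _ hN d p) => //; try exact: Pp;
    apply: flatxy => //; do ?[exact: Pp]; first [exact: Px.1|exact: Py.1].
have [t1 _ e1] : [set q + t *: v | t in [set: R]] x by apply: sub; left; left.
have [t2 _ e2] : [set q + t *: v | t in [set: R]] y by apply: sub; left; right.
have [t3 _ e3] : [set q + t *: v | t in [set: R]] w by apply: sub; right.
(* Collinearity puts [w] on the line through [x] and [y]; maximality of [N (x - y)] keeps it between
   them. *)
have [u ew u01] : exists2 u, w = (1 - u) *: x + u *: y & 0 <= u <= 1.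
  have xw := maxxy (x, w) (mem_set (conj Px Pw)).
  have wy := maxxy (w, y) (mem_set (conj Pw Py)).
  have [exy|xy] := eqVneq x y.
    exists 0; rewrite ?lexx ?ler01// subr0 scale1r scale0r addr0.
    move: xw; rewrite /= -exy subrr norm0// => xw.
    apply/esym/eqP; rewrite -subr_eq0; apply/eqP/(norm_definite hN)/eqP.
    by rewrite eq_le xw N_ge0.
  have t12 : t2 - t1 != 0.
    by apply: contra_neq xy => /eqP; rewrite subr_eq0 -e1 -e2 => /eqP ->.
  pose u := (t3 - t1) / (t2 - t1).
  have ew : w = (1 - u) *: x + u *: y.
    by rewrite -e1 -e2 -e3 /u; apply/rowP => i; rewrite !mxE; field.
  exists u => //; move: xw wy; rewrite /= ew.
  have -> : x - ((1 - u) *: x + u *: y) = u *: (x - y).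
    by apply/rowP => i; rewrite !mxE; ring.
  have -> : (1 - u) *: x + u *: y - y = (1 - u) *: (x - y).
    by apply/rowP => i; rewrite !mxE; ring.
  have Nxy : 0 < N (x - y).
    rewrite lt_neqAle N_ge0 andbT eq_sym; apply: contra_neq xy.
    by move=> /(norm_definite hN)/eqP; rewrite subr_eq0 => /eqP.
  rewrite !norm_homogeneous// !ger_pMl// !ler_norml => /andP[_ ?] /andP[_ ?].
  by apply/andP; split; lra.
have xs := C_diam Px.1 Cs; have ys := C_diam Py.1 Cs.
case/andP: u01 => u0 u1.
(* The midpoint [m] lies between [w] and the endpoint farther from [w]. That endpoint is within [d]
   of [s] and [m] is not closer than [d], so by convexity neither is [w]. *)
have [uh|uh] := leP u 2^-1.
  have := @norm_le_comb _ _ hN 1 (1 - 2 * u) (2 * (1 - u)) (w - s) (y - s)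
    (m - s) ler01.
  have -> : (2 * (1 - u)) *: (m - s) = 1 *: (w - s) + (1 - 2 * u) *: (y - s).
    by rewrite ew /m; apply/rowP => i; rewrite !mxE; field.
  have H1 : 0 <= 1 - 2 * u by lra.
  have H2 : 0 <= 2 * (1 - u) by lra.
  by move=> /(_ H1 H2 erefl); nra.
have := @norm_le_comb _ _ hN 1 (2 * u - 1) (2 * u) (w - s) (x - s) (m - s) ler01.
have -> : (2 * u) *: (m - s) = 1 *: (w - s) + (2 * u - 1) *: (x - s).
  by rewrite ew /m; apply/rowP => i; rewrite !mxE; field.
have H1 : 0 <= 2 * u - 1 by lra.
have H2 : 0 <= 2 * u by lra.
by move=> /(_ H1 H2 erefl); nra.
Qed.
End SphericalHull.

(** * Uniform bounds and counting for finite families *)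

Lemma exists_uniform_lt (R : realType) m (d : R) (P : 'I_m -> R -> Prop) :
  (forall i a b, a <= b -> P i a -> P i b) ->
  (forall i, exists2 a, a < d & P i a) ->
  exists2 a, a < d & forall i, P i a.
Proof.
move=> Pmono Pex.
have /choice[f fP] : forall i, exists a, a < d /\ P i a.
  by move=> i; have [a ad Pa] := Pex i; exists a.
(* The default [d - 1] keeps the maximum below [d] even for an empty family. *)
exists (\big[Num.max/d - 1]_i f i).
  by apply/bigmax_lt => [|i _]; [rewrite ltrBlDr ltrDl | case: (fP i)].
by move=> i; apply: Pmono (fP i).2; exact: le_bigmax.
Qed.

Lemma leq_card_pred (I : finType) (A B : pred I) (k : nat) :
  (forall i, A i -> B i) -> (k <= #|[pred i | A i]|)%N ->
  (k <= #|[pred i | B i]|)%N.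
Proof.
move=> AB kA; apply: leq_trans kA _; apply: subset_leq_card.
by apply/fintype.subsetP => i; exact: AB.
Qed.

Lemma closure_min (T : topologicalType) (A B : set T) :
  closed B -> A `<=` B -> closure A `<=` B.
Proof. by move=> /closure_id {2}-> AB; exact: closure_subset. Qed.

(** Points near [x] belong only to members whose closure contains [x], and some of these points are
    in [S]. *)
Lemma leq_card_closure (T : topologicalType) (k m : nat) (Q : 'I_m -> set T) (S : set T) :
  (forall x, S x -> (k <= #|[pred i | x \in Q i]|)%N) ->
  forall x, closure S x -> (k <= #|[pred i | x \in closure (Q i)]|)%N.
Proof.
move=> Qk x clSx.
have : \forall y \near x, forall i, Q i y -> closure (Q i) x.
  apply: filter_forall => i.
  have [clQ|nclQ] := pselect (closure (Q i) x); first by near=> y.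
  have : nbhs x (~` closure (Q i)).
    by apply: open_nbhs_nbhs; split => //; exact/closed_openC/closed_closure.
  by apply: filterS => y nQ /subset_closure.
move/clSx => [y [Sy yQ]].
apply: leq_card_pred (Qk _ Sy) => i.
by rewrite !inE; exact: yQ.
Unshelve. all: by end_near. Qed.

(** * Extension of closed coverings, one small ball at a time *)

Section Extension.
Variables (R : realType) (N : 'rV[R]_2 -> R) (hN : is_norm N).
Implicit Types (x y z s p : 'rV[R]_2) (a b c d e : R) (k m : nat).

Variables (nangled : ~ angled N) (C : set 'rV[R]_2) (d : R).
Hypotheses (d_gt0 : 0 < d) (C_closed : closed C) (C_compact : compact C)
  (C_diam : forall x y, C x -> C y -> N (x - y) <= d).

(** This property survives enlarging [T] to a larger closed subset of [C], which lets the extension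
    be iterated. *)
Definition determines (T : set 'rV[R]_2) :=
  [/\ closed T, T !=set0, T `<=` C &
      forall z, (forall s, T s -> N (z - s) <= d) -> C z].

(** The members may leave [T] within [C], and one bound [e < d] serves all of them, so that an
    extended covering is again of this form. *)
Definition closed_covering k (T : set 'rV[R]_2) m (Q : 'I_m -> set 'rV[R]_2) :=
  [/\ forall i, closed (Q i), forall i, Q i `<=` C,
      exists2 e, e < d & forall i x y, Q i x -> Q i y -> N (x - y) <= e &
      forall x, T x -> (k <= #|[pred i | x \in Q i]|)%N].

Lemma extend_covering k T m (Q : 'I_m -> set 'rV[R]_2) U e0 :
  determines T -> closed_covering k T Q -> closed U -> e0 < d ->
  (forall x y, U x -> U y -> N (x - y) <= e0) ->
  exists2 Q' : 'I_m -> set 'rV[R]_2, closed_covering k (T `|` (C `&` U)) Q' &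
    forall i, Q i `<=` Q' i.
Proof.
move=> [Tcl T0 TC Thull] [Qcl QC [e ed Qe] Qk] Ucl e0d Ue0.
pose near_all a p i := forall x, Q i x -> N (x - p) <= a.
have near_all_le p i a b : a <= b -> near_all a p i -> near_all b p i.
  by move=> ab H x /H/le_trans; apply.
have Tc : compact T by exact: subclosed_compact Tcl C_compact TC.
(* A member containing the dominating point [q] has no point at distance [d] or more from [p]; its
   compactness gives a bound below [d]. *)
have pointwise p : C p ->
    exists2 a, a < d & (k <= #|[pred i | `[< near_all a p i >]]|)%N.
  move=> Cp; have [q Tq dom] :=
    opposite_dominated hN d_gt0 Tc T0 TC C_diam Thull nangled Cp C_closed.
  have [||a ad aP] := @exists_uniform_lt R m d (fun i a => Q i q -> near_all a p i).
  - by move=> i a b ab H /H; exact: near_all_le.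
  - move=> i; have [Qq|nQq] := pselect (Q i q); last by exists e.
    have Qc : compact (Q i) by exact: subclosed_compact (Qcl i) C_compact (QC i).
    have [||x] := @compact_EVT_max _ _ (fun x => N (x - p)) (Q i) _ Qc.
    + by exists q.
    + by apply: continuous_subspaceT; exact: continuous_dist.
    rewrite inE => Qx maxx; exists (N (x - p)).
      rewrite ltNge; apply/negP => /(dom _ (QC _ _ Qx)).
      by move/le_trans/(_ (Qe _ _ _ Qx Qq)); rewrite leNgt ed.
    by move=> _ y /mem_set/maxx.
  exists a => //; apply: leq_card_pred (Qk _ Tq) => i.
  by rewrite inE => Qq; apply/asboolP; exact: aP.
have [a ad aP] : exists2 a, a < d & forall p, C p ->
    (k <= #|[pred i | `[< near_all a p i >]]|)%N.
  pose P a p := (k <= #|[pred i | `[< near_all a p i >]]|)%N.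
  have Pnear : \forall a \near d^'-, C `<=` P a.
    apply: (compact_near_coveringP C).1 => // p Cp.
    have [a ad aP] := pointwise p Cp.
    (* Half of the gap: the bound [a] at [p] becomes [a + h < d] at every point within [h] of
       [p]. *)
    pose h := (d - a) / 2.
    have h0 : 0 < h by rewrite divr_gt0// subr_gt0.
    exists ([set q | N (q - p) < h], [set b | a + h < b]) => /=; last first.
      move=> [q b] /= [qp ab]; rewrite /P; apply: leq_card_pred aP => i /asboolP H.
      apply/asboolP => x /H xp; apply: le_trans (norm_dist_triangle hN p _ _) _.
      by rewrite [N (p - q)]norm_distC//; lra.
    split.
      have ph : \forall y \near N (p - p), y < h.
        by apply: lt_nbhsl; rewrite subrr norm0.
      exact: (@continuous_dist _ _ hN p p _ ph).
    by apply: nbhs_left_gt; rewrite /h; lra.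
  have [a [ad aP]] : exists a, a < d /\ C `<=` P a.
    near (d^'-) => a; exists a; split; near: a => //.
    exact: nbhs_left_lt.
  by exists a.
pose Q' i := Q i `|` (C `&` U `&` [set p | near_all a p i]).
exists Q'; last by move=> i x; left.
split.
- move=> i; apply: closedU; first exact: Qcl.
  apply: closedI; first exact: closedI.
  rewrite (_ : mkset _ = \bigcap_(x in Q i) [set p | N (p - x) <= a]); last first.
    by apply/seteqP; split => p /= H x /H; rewrite norm_distC.
  apply: closed_bigI => x _.
  exact: closed_norm_ball.
- by move=> i x [/QC//|[[]]].
(* Two old points are within [e], an old and a new one within [a], and two new ones, both in [U],
   within [e0]. *)
- exists (Num.max a (Num.max e e0)); first by rewrite !gt_max ad ed.
  move=> i x y; rewrite !le_max.
  move=> [Qx|[[_ Ux] xa]] [Qy|[[_ Uy] ya]].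
  + by rewrite (Qe i)// orbT.
  + by rewrite (ya x).
  + by rewrite norm_distC// (xa y).
  + by rewrite (Ue0 x y)// !orbT.
- move=> x [Tx|[Cx Ux]].
    by apply: leq_card_pred (Qk _ Tx) => i; rewrite !inE; left.
  apply: leq_card_pred (aP _ Cx) => i /asboolP H.
  by rewrite inE; right.
Unshelve. all: by end_near. Qed.

(** Finitely many balls of radius [d / 4] cover [C]; each has diameter at most [d / 2 < d] and can
    play the role of [U]. *)
Lemma extend_covering_whole k T m (Q : 'I_m -> set 'rV[R]_2) :
  determines T -> closed_covering k T Q ->
  exists2 Q' : 'I_m -> set 'rV[R]_2, closed_covering k C Q' &
    forall i, Q i `<=` Q' i.
Proof.
move=> dT cQ.
have [us usP] : exists us : seq 'rV[R]_2,
    C `<=` [set x | exists2 u, u \in us & N (x - u) <= d / 4].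
  move: C_compact; rewrite compact_cover.
  move=> /(_ _ C (fun u => [set x | N (x - u) < d / 4])).
  case=> [u _||D _ CD].
  - apply: (@open_comp _ _ (fun x => N (x - u)) [set y | y < d / 4]).
      by move=> x _; exact: continuous_dist.
    exact: open_lt.
  - move=> x Cx; exists x => //=; rewrite subrr norm0// divr_gt0//.
  exists (finmap.enum_fset D) => x /CD[u /= uD xu]; exists u => //.
  exact: ltW.
suff [Q' [Q'cl Q'C Q'e Q'k] QQ'] : exists2 Q' : 'I_m -> set 'rV[R]_2,
    closed_covering k
      (T `|` (C `&` [set x | exists2 u, u \in us & N (x - u) <= d / 4])) Q' &
    forall i, Q i `<=` Q' i.
  by exists Q' => //; split => // x Cx; apply: Q'k; right; split => //; exact: usP.
(* [T] and [Q] are generalized because absorbing a ball enlarges both. *)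
elim: us T Q dT cQ {usP} => [|u us IH] T Q dT cQ.
  exists Q; last by move=> i; exact: subset_refl.
  by case: cQ => ? ? ? Qk; split => // x [/Qk//|[_ [v]]].
pose U := [set x | N (x - u) <= d / 4].
have Ucl : closed U by exact: closed_norm_ball.
have [||Q1 cQ1 QQ1] := @extend_covering k T m Q U (d / 2) dT cQ Ucl.
- by move: d_gt0; lra.
- move=> x y xu yu; apply: le_trans (norm_dist_triangle hN u _ _) _.
  have -> : d / 2 = d / 4 + d / 4 by field.
  by rewrite lerD// norm_distC.
have [|Q2 [Q2cl Q2C Q2e Q2k] Q1Q2] := IH (T `|` (C `&` U)) Q1 _ cQ1.
  case: dT => Tcl [t Tt] TC Thull; split.
  - by apply: closedU => //; exact: closedI.
  - by exists t; left.
  - by move=> x [/TC//|[]].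
  - by move=> z zT; apply: Thull => s Ts; apply: zT; left.
exists Q2; last by move=> i; apply: subset_trans (QQ1 i) (Q1Q2 i).
split => // x Tx; apply: Q2k; case: Tx => [Tx|[Cx [v]]]; first by left; left.
rewrite inE => /orP[/eqP -> xu|vus xv]; first by left; right.
by right; split => //; exists v.
Qed.

End Extension.

(** * Diameters, closures, and the completion as an intersection of balls *)

Section UniqueCompletion.
Variables (R : realType) (N : 'rV[R]_2 -> R) (hN : is_norm N).
Implicit Types (x y z s : 'rV[R]_2) (A S C : set 'rV[R]_2) (d e : R).

Lemma diam_leP A e :
  (diam N A <= e%:E)%E <-> (forall x y, A x -> A y -> N (x - y) <= e).
Proof.
split => [Ae x y Ax Ay|H].
  rewrite -lee_fin; apply: le_trans Ae; apply: ereal_sup_ubound.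
  by exists x => //; exists y.
by apply: ge_ereal_sup => _ [x Ax [y Ay <-]]; rewrite lee_fin; exact: H.
Qed.

Lemma le_diam A B : A `<=` B -> (diam N A <= diam N B)%E.
Proof.
move=> AB; apply: le_ereal_sup => _ [x Ax [y Ay <-]].
by exists x; [exact: AB|exists y => //; exact: AB].
Qed.

Lemma diam_fin S : (0 < diam N S)%E -> norm_bounded N S ->
  exists2 d, 0 < d & diam N S = d%:E.
Proof.
move=> S0 [M SM].
have : (diam N S <= (M + M)%:E)%E.
  apply/diam_leP => x y Sx Sy; apply: le_trans (norm_triangle hN _ _) _.
  by rewrite normN// lerD// SM.
by case: (diam N S) S0 => [d|//|//] d0 _; exists d.
Qed.

(** Adding [z] to [S] keeps the diameter; a maximal set of this diameter containing both is a
    completion of [S], hence equal to [C]. *)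
Lemma is_completion_hull S C d : diam N S = d%:E -> S !=set0 ->
  unique_completion N S -> is_completion N S C ->
  forall z, (forall s, S s -> N (z - s) <= d) -> C z.
Proof.
move=> Sd [s0 Ss0] [_ [C0 [_ C0uniq]]] Ccomp z zS.
have Sdiam x y : S x -> S y -> N (x - y) <= d.
  by move: x y; apply/diam_leP; rewrite Sd.
have d0 : 0 <= d by have := Sdiam _ _ Ss0 Ss0; rewrite subrr norm0.
pose S1 := S `|` [set z].
(* Including [S1] in the condition, instead of requiring [A] to contain it, makes [P] hold for the
   union of the empty chain too. *)
pose P A := forall x y, (A `|` S1) x -> (A `|` S1) y -> N (x - y) <= d.
have S1d x y : S1 x -> S1 y -> N (x - y) <= d.
  move=> [Sx|->] [Sy|->]; first exact: Sdiam.
  - by rewrite norm_distC// zS.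
  - exact: zS.
  - by rewrite subrr norm0.
have [|A [PA Amax]] := @Zorn_bigcup _ P.
  move=> F FP Ftot x y [[X FX Xx]|S1x] [[Y FY Yy]|S1y].
  - have [XY|YX] := Ftot _ _ FX FY.
      by apply: (FP _ FY); left => //; exact: XY.
    by apply: (FP _ FX); left => //; exact: YX.
  - by apply: (FP _ FX); [left|right].
  - by apply: (FP _ FY); [right|left].
  - exact: S1d.
have S1A : S1 `<=` A.
  apply: contrapT => nS; apply: (Amax (A `|` S1)).
    by split; [move=> x; left|move=> H; apply: nS => x S1x; apply: H; right].
  by rewrite /P -setUA setUid.
have SA : S `<=` A by move=> x Sx; apply: S1A; left.
have Ad : diam N A = d%:E.
  apply/eqP; rewrite eq_le -{2}Sd le_diam// andbT.
  by apply/diam_leP => x y Ax Ay; apply: PA; left.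
suff compA : is_completion N S A.
  by rewrite -(C0uniq _ Ccomp) (C0uniq _ compA); apply: S1A; right.
split => //; last by rewrite Sd.
split.
  exists (d + N s0) => x Ax; have := norm_triangle hN (x - s0) s0.
  rewrite subrK => /le_trans; apply; rewrite lerD2r.
  by apply: PA; left => //; exact: SA.
move=> [D [AD Dd]]; apply: (Amax D AD) => x y.
have -> : D `|` S1 = D.
  by apply/setUidPl; apply: subset_trans S1A _; case: AD.
by move: x y; apply/diam_leP; rewrite Dd Ad.
Qed.

(** Balls are closed, so the bound passes to the closure in one variable at a time. *)
Lemma closure_norm_le S e :
  (forall x y, S x -> S y -> N (x - y) <= e) ->
  forall x y, closure S x -> closure S y -> N (x - y) <= e.
Proof.
move=> Se.
have half y : S y -> closure S `<=` [set x | N (x - y) <= e].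
  by move=> Sy; apply: closure_min => [|x Sx]; [exact: closed_norm_ball|exact: Se].
move=> x y clx cly; rewrite norm_distC//.
suff : closure S `<=` [set z | N (z - x) <= e] by apply.
apply: closure_min => [|z Sz]; first exact: closed_norm_ball.
by rewrite /= norm_distC//; exact: half Sz _ clx.
Qed.

End UniqueCompletion.

Theorem theorem2 (R : realType) (N : 'rV[R]_2 -> R) (hN : is_norm N)
    (hangled : ~ angled N) (S C : set 'rV[R]_2)
    (hdiam : (0 < diam N S)%E) (hS : unique_completion N S)
    (hC : is_completion N S C) (k : nat) (hk : (0 < k)%N)
    (m : nat) (Q : 'I_m -> set 'rV[R]_2) (hQ : borsuk_covering N k S Q) :
  exists Q' : 'I_m -> set 'rV[R]_2,
    borsuk_covering N k C Q' /\ (forall i, Q i `<=` Q' i).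
Proof.
have [d d0 Sd] := diam_fin hN hdiam hS.1.
have S0 : S !=set0.
  apply/set0P; apply/eqP => S0; have : (diam N S <= 0%:E)%E.
    by apply/diam_leP => x y; rewrite S0.
  by rewrite leNgt hdiam.
have hull := is_completion_hull hN Sd S0 hS hC.
have [_ SC Cd] := hC.
have C_diam x y : C x -> C y -> N (x - y) <= d.
  by move: x y; apply/diam_leP; rewrite Cd Sd.
have C_eq : C = \bigcap_(s in S) [set z | N (z - s) <= d].
  apply/seteqP; split => [z Cz s /SC Cs|z]; [exact: C_diam | exact: hull].
have C_closed : closed C.
  rewrite C_eq; apply: closed_bigI => s _.
  exact: closed_norm_ball.
have C_compact : compact C.
  apply: (norm_bounded_closed_compact hN) => //.
  have [s Ss] := S0; exists (d + N s) => x Cx.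
  have := norm_triangle hN (x - s) s; rewrite subrK => /le_trans; apply.
  by rewrite lerD2r C_diam//; exact: SC.
have clC A : A `<=` C -> closure A `<=` C.
  exact: closure_min.
have [QS Qd Qk] := hQ.
have [||e ed Qe] := @exists_uniform_lt R m d
    (fun i e => forall x y, Q i x -> Q i y -> N (x - y) <= e).
- by move=> i a b ab H x y Qx Qy; apply: le_trans ab; exact: H.
- move=> i; have := Qd i; rewrite Sd.
  case E : (diam N (Q i)) => [a||] //.
    by rewrite lte_fin => ad; exists a => //; apply/diam_leP; rewrite E.
  (* The diameter is [-oo] here, as for an empty member, so [0] is a valid bound below [d]. *)
  by move=> _; exists 0 => //; apply/diam_leP; rewrite E leNye.
have dT : determines N C d (closure S).
  split; [exact: closed_closure | | exact: clC |].
  - by have [s Ss] := S0; exists s; exact: subset_closure.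
  - by move=> z H; apply: hull => s Ss; apply: H; exact: subset_closure.
(* Closures keep the diameter bound and the multiplicity, and they stay in [C] because [C] is
   closed. *)
have cQ : closed_covering N C d k (closure S) (fun i => closure (Q i)).
  split; [by move=> i; exact: closed_closure | | | exact: leq_card_closure].
  - by move=> i; apply: clC; exact: subset_trans (QS i) SC.
  - by exists e => // i; apply: closure_norm_le (Qe i).
have [Q' [_ Q'C [e' e'd Q'e] Q'k] QQ'] := extend_covering_whole hN hangled d0
  C_closed C_compact C_diam dT cQ.
exists Q'; split; last by move=> i; apply: subset_trans (@subset_closure _ _) (QQ' i).
split => // i; rewrite Cd Sd; apply: (@le_lt_trans _ _ e'%:E).
  by apply/diam_leP => x y; exact: Q'e.
by rewrite lte_fin.
Qed.
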